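(* Let $(F_n)_{n\in\omega}$ be a sequence of nonempty finite subsets of $\omega$ such that $\lim_{n\to\infty}|F_n|=\infty$, and let $$\mathcal{I}(\mathscr{F}):=\left\{A\subseteq\omega : \frac{|A\cap F_n|}{|F_n|}\to 0 \text{ as } n\to\infty\right\}.$$ Then $\mathcal{I}(\mathscr{F})$ is not an $F_\sigma$-ideal, i.e. it is not an $F_\sigma$ subset of $\mathcal{P}(\omega)$.
   Context: $\omega$ denotes the set of nonnegative integers, and $\mathscr{F}=(F_n)$. An ideal on $\omega$ is a collection of subsets of $\omega$ closed under subsets and finite unions; it is assumed to be proper (it does not contain $\omega$) and admissible (it contains every finite subset of $\omega$). The power set $\mathcal{P}(\omega)$ is endowed with the Cantor-space topology, i.e. it is identified with $\{0,1\}^{\omega}$ with the product topology, and an ideal is called $F_\sigma$ if it is an $F_\sigma$ subset (a countable union of closed subsets) of this space. *)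

(* Defs.v *)
From HB Require Import structures.
From mathcomp Require Import all_boot all_order all_algebra finmap.
From mathcomp Require Import all_classical all_reals all_analysis borel_hierarchy.

Set Implicit Arguments.
Unset Strict Implicit.
Unset Printing Implicit Defensive.

Import Order.TTheory GRing.Theory Num.Theory.
Import numFieldNormedType.Exports.

Local Open Scope classical_set_scope.
Local Open Scope ring_scope.

(* The identification of P(omega) with {0,1}^omega; [cantor_space] carries the
   product of the discrete topologies. *)
Definition char_seq (A : set nat) : cantor_space := fun k : nat => `[< A k >].

Definition Fsigma_family (I : set (set nat)) : Prop := Fsigma (char_seq @` I).

Definition rel_density (R : realType) (F : nat -> {fset nat}) (A : set nat)
    (n : nat) : R :=
  #|` [fset k in F n | k \in A]%fset |%:R / #|` F n |%:R.

Definition density_ideal (R : realType) (F : nat -> {fset nat}) :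
    set (set nat) :=
  [set A | rel_density R F A n @[n --> \oo] --> (0 : R)].

(* Main.v *)
Require Import Defs.
From HB Require Import structures.
From mathcomp Require Import all_boot all_order all_algebra finmap.
From mathcomp Require Import all_classical all_reals all_analysis borel_hierarchy.
From mathcomp Require Import lra.

Import Order.TTheory GRing.Theory Num.Theory.
Import numFieldNormedType.Exports.

Local Open Scope classical_set_scope.
Local Open Scope ring_scope.

(** Write d_n(A) for the proportion of F n lying in A, and call A e-thin when
    d_n(A) <= e for every n.  Suppose the ideal were a union of closed sets
    C_0, C_1, ...  A diagonal argument in the style of Baire produces a member
    A of the ideal that lies in no C_m.

    The heart of the matter is that, for every e > 0 and every N, there is an
    e-thin subset B of [N, oo) outside the ideal ([exists_thin_not_ideal]).
    Take B maximal among the e-thin subsets of [N, oo).  If B were in the ideal,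
    then d_n(B) would be at most e/2 for all large n, while one extra point
    costs at most 1/|F n|.  A large point k belongs only to sets F n with n
    large, so it could be added to B without destroying e-thinness; by
    maximality it is already in B.  Thus B is cofinite, so d_n(B) tends to 1,
    because |F n| tends to infinity: a contradiction.

    Given a finite approximation S below N, adjoining such a B gives a set
    outside the ideal, hence outside C_m.  As C_m is closed, this exclusion
    depends only on some initial segment [0, N') ([closed_avoid_cylinder]).
    One may therefore freeze S and B below N' and proceed to C_(m+1), with e
    halved ([extend_avoiding]).  The limit A of the approximations avoids all
    C_m, and its part beyond the m-th bound N m is a union of pieces that are
    thin for 2^-m, 2^-(m+1), ..., so that
    d_n(A) <= N m / |F n| + 2 * 2^-m, which shows that A is in the ideal. *)

(** * Relative density as a submeasure *)

Lemma rel_density_ge0 (R : realType) (F : nat -> {fset nat}) A n :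
  0 <= rel_density R F A n.
Proof. by rewrite divr_ge0. Qed.

(** Only the traces on F n matter, which lets a set such as an infinite union
    be compared with a finite stage of its construction. *)
Lemma rel_density_le_setU (R : realType) (F : nat -> {fset nat}) A B C n :
    (forall k, k \in F n -> A k -> B k \/ C k) ->
  rel_density R F A n <= rel_density R F B n + rel_density R F C n.
Proof.
move=> sABC; rewrite /rel_density -mulrDl -natrD ler_wpM2r ?invr_ge0 // ler_nat.
rewrite -cardfsUI; apply/(leq_trans _ (leq_addr _ _))/fsubset_leq_card.
apply/fsubsetP => k; rewrite !inE => /andP[kF /set_mem Ak]; rewrite kF /=.
by case: (sABC k kF Ak) => ?; apply/orP; [left|right]; rewrite mem_set.
Qed.

Lemma rel_density_le (R : realType) (F : nat -> {fset nat}) A B n :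
    (forall k, k \in F n -> A k -> B k) ->
  rel_density R F A n <= rel_density R F B n.
Proof.
move=> sAB; rewrite /rel_density ler_wpM2r ?invr_ge0 // ler_nat fsubset_leq_card //.
apply/fsubsetP => k; rewrite !inE => /andP[kF /set_mem Ak]; rewrite kF /=.
by rewrite mem_set //; apply: sAB.
Qed.

Lemma rel_density_setT (R : realType) (F : nat -> {fset nat}) n :
  F n <> fset0 -> rel_density R F setT n = 1.
Proof.
move=> Fn0; rewrite /rel_density.
have -> : [fset k in F n | k \in [set: nat]]%fset = F n.
  by apply/fsetP => k; rewrite !inE mem_set // andbT.
by rewrite divff // pnatr_eq0 cardfs_eq0; apply/eqP.
Qed.

Lemma rel_density_set0 (R : realType) (F : nat -> {fset nat}) n :
  rel_density R F set0 n = 0.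
Proof.
rewrite /rel_density (_ : [fset _ | _ in _ & _]%fset = fset0) ?cardfs0 ?mul0r //.
by apply/fsetP => k; rewrite !inE in_set0 andbF.
Qed.

Lemma rel_density_initial (R : realType) (F : nat -> {fset nat}) K n :
  rel_density R F `I_K n <= K%:R / #|` F n |%:R.
Proof.
rewrite /rel_density ler_wpM2r ?invr_ge0 // ler_nat.
rewrite -[leqRHS](size_iota 0).
apply: uniq_leq_size; first exact: fset_uniq.
by move=> k; rewrite !inE mem_iota /= => /andP[_ /set_mem].
Qed.

Lemma rel_density_set1 (R : realType) (F : nat -> {fset nat}) k n :
  rel_density R F [set k] n <= 1 / #|` F n |%:R.
Proof.
rewrite /rel_density ler_wpM2r ?invr_ge0 // lern1 -(cardfs1 k) fsubset_leq_card //.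
by apply/fsubsetP => j; rewrite !inE => /andP[_ /set_mem ->].
Qed.

Lemma density_idealP (R : realType) (F : nat -> {fset nat}) A :
  density_ideal R F A <->
  forall e : R, 0 < e -> exists n0, forall n, (n0 <= n)%N ->
    rel_density R F A n <= e.
Proof.
split=> [/cvgr0Pnorm_le lim0 e e0|lim0].
  have [n0 _ n0P] := lim0 _ e0; exists n0 => n n0n.
  by have := n0P n n0n; rewrite /= ger0_norm // rel_density_ge0.
apply/cvgr0Pnorm_le => e /lim0[n0 n0P]; exists n0 => // n /= n0n.
by rewrite ger0_norm ?rel_density_ge0 // n0P.
Qed.

Lemma density_ideal_sub (R : realType) (F : nat -> {fset nat}) A B :
  A `<=` B -> density_ideal R F B -> density_ideal R F A.
Proof.
move=> sAB /density_idealP IB; apply/density_idealP => e /IB[n0 n0P].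
exists n0 => n /n0P; apply: le_trans.
by apply: rel_density_le => k _; apply: sAB.
Qed.

Lemma natr_div_card_small (R : realType) (F : nat -> {fset nat}) (K : nat)
    (e : R) : #|` F n | @[n --> \oo] --> \oo -> 0 < e ->
  exists n0, forall n, (n0 <= n)%N -> K%:R / #|` F n |%:R <= e.
Proof.
move=> /cvgnyPge/(_ (Num.truncn (K%:R / e)).+1)[n0 _ n0P] e0.
exists n0 => n /n0P/= cF.
have {}cF : K%:R / e < #|` F n |%:R.
  by rewrite (lt_le_trans (truncnS_gt _)) // ler_nat.
have F0 : (0 : R) < #|` F n |%:R by apply: le_lt_trans cF; rewrite divr_ge0 // ltW.
by rewrite ler_pdivrMr // mulrC -ler_pdivrMr // ltW.
Qed.

(** Used contrapositively: a large point belongs only to sets F n of large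
    index. *)
Lemma finite_family_bounded (F : nat -> {fset nat}) n0 :
  exists M, forall n k, (n < n0)%N -> k \in F n -> (k < M)%N.
Proof.
exists (\max_(n < n0) \max_(k <- F n) k).+1 => n k n_n0 kF; rewrite ltnS.
apply: leq_trans (leq_bigmax (Ordinal n_n0)).
by rewrite (leq_bigmax_seq (F := id)).
Qed.

(** * Small sets outside the ideal *)

Definition thin (R : realType) (F : nat -> {fset nat}) (e : R) (A : set nat) :=
  forall n, rel_density R F A n <= e.

Fixpoint greedy (R : realType) (F : nat -> {fset nat}) (e : R) (N K : nat) :
    set nat :=
  if K is k.+1 then
    let G := greedy R F e N k in
    if `[< (N <= k)%N /\ thin R F e (G `|` [set k]) >] then G `|` [set k] else G
  else set0.

(** Since every F n is finite, e-thinness is a property of finite character, so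
    the union of the greedy stages is still e-thin; a point rejected by the
    scan was already incompatible with a subset of the final B. *)
Lemma exists_maximal_thin (R : realType) (F : nat -> {fset nat}) (e : R) N :
  0 <= e -> exists B : set nat, [/\ thin R F e B, forall k, B k -> (N <= k)%N &
    forall k, (N <= k)%N -> thin R F e (B `|` [set k]) -> B k].
Proof.
move=> e0; pose g := greedy R F e N; pose B := \bigcup_K g K.
have gS K : g K `<=` g K.+1 by rewrite /g /=; case: ifP => _ k // ?; left.
have g_mono K L : (K <= L)%N -> g K `<=` g L.
  move=> /subnK <-; elim: (L - K)%N => // d IH; rewrite addSn.
  exact: subset_trans IH (gS _).
have g_thin K : thin R F e (g K).
  elim: K => [|K IH]; first by move=> n; rewrite rel_density_set0.
  by rewrite /g /=; case: ifP => [/asboolP[]|].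
have g_ge K k : g K k -> (N <= k)%N.
  elim: K => // K IH; rewrite /g /=.
  by case: ifP => [/asboolP[NK _] [/IH|->]|_ /IH].
(* The stage k -> k.+1 is the only one that can add the point k. *)
have g_last K k : g K k -> g k.+1 k.
  elim: K => // K IH; rewrite {1}/g /=.
  case: ifP => [gK|_ /IH //] [/IH //|->]; rewrite /g /= gK; by right.
have B_initial K k : (k < K)%N -> B k -> g K k.
  by move=> kK [L _ /g_last]; apply: g_mono.
exists B; split=> [n|k [K _]|k Nk BkT]; first 2 last.
- exists k.+1 => //; rewrite /g /= asboolT; first by right.
  split=> // n; apply: le_trans (BkT n); apply: rel_density_le => j _.
  by case=> [gj|->]; [left; exists k|right].
- have [M MP] := finite_family_bounded F n.+1.
  apply: le_trans (g_thin M n); apply: rel_density_le => k kF.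
  by apply: B_initial; apply: MP kF.
- exact: g_ge.
Qed.

(** A maximal e-thin set in the ideal would leave room, in every F n with n
    large, for one more point; it would therefore contain all large points, and
    a cofinite set is not in the ideal. *)
Lemma exists_thin_not_ideal (R : realType) (F : nat -> {fset nat}) (e : R) N :
    (forall n, F n <> fset0) -> #|` F n | @[n --> \oo] --> \oo -> 0 < e ->
  exists B, [/\ thin R F e B, forall k, B k -> (N <= k)%N &
    ~ density_ideal R F B].
Proof.
move=> F_neq0 F_card e0.
have [B [BT BN Bmax]] := exists_maximal_thin R F e N (ltW e0).
exists B; split=> // /density_idealP IB.
have e2 : 0 < e / 2 by rewrite divr_gt0.
have [n1 n1P] := IB _ e2.
have [n2 n2P] := natr_div_card_small R F 1 _ F_card e2.
have [M MP] := finite_family_bounded F (maxn n1 n2).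
have B_cofinite k : (maxn M N <= k)%N -> B k.
  rewrite geq_max => /andP[Mk Nk]; apply: Bmax => // n.
  (* The new point is invisible in F n unless k is in F n, and then n is large
     because k >= M. *)
  have [kF|kF] := boolP (k \in F n); last first.
    apply: le_trans (BT n); apply: rel_density_le => j jF [//|jk].
    by rewrite jk (negbTE kF) in jF.
  have : (maxn n1 n2 <= n)%N.
    by rewrite leqNgt; apply/negP => /MP/(_ kF); rewrite ltnNge Mk.
  rewrite geq_max => /andP[/n1P le1 /n2P le2].
  apply: le_trans (rel_density_le_setU _ _ _ B [set k] _ _) _ => //.
  by have := rel_density_set1 R F k n; lra.
(* Any q with q + q < 1 would do: F n is covered by B and an initial segment,
   each of relative density at most q for n large. *)
have q0 : (0 : R) < 1 / 4 by lra.
have [n3 n3P] := IB _ q0.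
have [n4 n4P] := natr_div_card_small R F (maxn M N) _ F_card q0.
set n := maxn n3 n4; have {n3P}Bn := n3P n (leq_maxl _ _).
have {n4P}In := n4P n (leq_maxr _ _).
have := rel_density_le_setU R F setT B `I_(maxn M N) n.
rewrite rel_density_setT //.
have := rel_density_initial R F (maxn M N) n.
suff H : forall k, k \in F n -> setT k -> B k \/ `I_(maxn M N) k.
  by move=> le1 /(_ H); lra.
move=> k _ _; have [kM|Mk] := ltnP k (maxn M N); first by right.
by left; apply: B_cofinite.
Qed.

(** * The diagonal construction *)

Definition agree_below (N : nat) (A B : set nat) :=
  forall k, (k < N)%N -> A k <-> B k.

Lemma char_seq_inj : injective char_seq.
Proof.
move=> A B AB; apply/funext => k; apply/propext.
by apply: asbool_eq_equiv; have := congr1 (fun x : cantor_space => x k) AB.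
Qed.

(** Otherwise there are members of C agreeing with B on arbitrarily long initial
    segments; they converge to B pointwise, that is, in the product topology,
    and B would belong to the closed set C. *)
Lemma closed_avoid_cylinder (C : set cantor_space) B :
    closed C -> ~ C (char_seq B) ->
  exists N, forall A, agree_below N A B -> ~ C (char_seq A).
Proof.
move=> Ccl CB; apply: contrapT => noN.
have {noN}/choice[A_ AP] N : exists A, agree_below N A B /\ C (char_seq A).
  apply: contrapT => noA; apply: noN; exists N => A AB CA.
  by apply: noA; exists A.
apply: CB.
apply: (@closed_cvg _ _ \oo _ (fun N => char_seq (A_ N)) C Ccl).
  by near=> N; case: (AP N).
apply/(@pointwise_cvgP nat bool) => k; apply/discrete_cvg.
exists k.+1 => // N /= kN; apply/asbool_equiv_eq.
by have [AB _] := AP N; apply: AB.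
Unshelve. all: by end_near.
Qed.

(** Take for S' the part of S below N together with a thin set outside the
    ideal: S' is then outside the ideal, hence outside C, and as C is closed
    finitely many points of S' suffice to witness this. *)
Lemma extend_avoiding (R : realType) (F : nat -> {fset nat})
    (C : set cantor_space) (e : R) (S : set nat) (N : nat) :
    (forall n, F n <> fset0) -> #|` F n | @[n --> \oo] --> \oo -> 0 < e ->
    closed C -> C `<=` char_seq @` density_ideal R F ->
  exists S' N', [/\ (N < N')%N, agree_below N S' S,
    thin R F e [set k | S' k /\ (N <= k)%N] &
    forall A, agree_below N' A S' -> ~ C (char_seq A)].
Proof.
move=> F_neq0 F_card e0 Ccl CI.
have [B [BT BN BI]] := exists_thin_not_ideal R F e N F_neq0 F_card e0.
pose S' := [set k | (S k /\ (k < N)%N) \/ B k].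
have /(closed_avoid_cylinder _ _ Ccl)[N' N'P] : ~ C (char_seq S').
  move=> /CI[A IA /char_seq_inj AS]; apply: BI.
  by apply: density_ideal_sub IA; rewrite AS => k; right.
exists S', (maxn N N').+1; split.
- by rewrite ltnS leq_maxl.
- move=> k kN; split=> [[[]//|/BN]|Sk]; last by left.
  by rewrite leqNgt kN.
- move=> n; apply: le_trans (BT n); apply: rel_density_le => k _ [].
  by case=> [[_ kN]|//]; rewrite leqNgt kN.
- move=> A AS; apply: N'P => k kN'; apply: AS.
  by rewrite ltnS (leq_trans (ltnW kN')) ?leq_maxr.
Qed.

Theorem theorem2p4 (R : realType) (F : nat -> {fset nat})
    (F_neq0 : forall n : nat, F n <> fset0)
    (F_card : #|` F n | @[n --> \oo] --> \oo) :
  ~ Fsigma_family (density_ideal R F).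
Proof.
move=> [C Ccl CI].
have CsubI m : C m `<=` char_seq @` density_ideal R F.
  by rewrite CI => x Cx; exists m.
have /choice[next nextP] (p : nat * (set nat * nat)) : exists q : set nat * nat,
    [/\ (p.2.2 < q.2)%N, agree_below p.2.2 q.1 p.2.1,
    thin R F (2^-1 ^+ p.1 : R) [set k | q.1 k /\ (p.2.2 <= k)%N] &
    forall A, agree_below q.2 A q.1 -> ~ C p.1 (char_seq A)].
  case: p => m [S N] /=.
  have e0 : 0 < 2^-1 ^+ m :> R by rewrite exprn_gt0 // invr_gt0.
  have [S' [N' H]] :=
    extend_avoiding R F (C m) _ S N F_neq0 F_card e0 (Ccl m) (CsubI m).
  by exists (S', N').
(* (S m, N m) is the state before C m is treated. *)
pose st := fix st m := if m is m'.+1 then next (m', st m') else (set0, 0%N).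
pose S m := (st m).1; pose N m := (st m).2.
have NS m : (N m < N m.+1)%N by case: (nextP (m, st m)).
have SS m : agree_below (N m) (S m.+1) (S m) by case: (nextP (m, st m)).
have ST m : thin R F (2^-1 ^+ m : R) [set k | S m.+1 k /\ (N m <= k)%N].
  by case: (nextP (m, st m)).
have SC m A : agree_below (N m.+1) A (S m.+1) -> ~ C m (char_seq A).
  by case: (nextP (m, st m)) => _ _ _; apply.
have N_mono i j : (i <= j)%N -> (N i <= N j)%N.
  move=> /subnK <-; elim: (j - i)%N => // d IH.
  exact: leq_trans IH (ltnW (NS _)).
have N_ge m : (m <= N m)%N by elim: m => // m IH; apply: leq_ltn_trans (NS m).
have S_agree i j : (i <= j)%N -> agree_below (N i) (S j) (S i).
  move=> ij; rewrite -(subnK ij); elim: (j - i)%N => // d IH k kN.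
  rewrite addSn; apply: iff_trans (IH k kN); apply: SS.
  by apply: leq_trans kN _; rewrite N_mono // leq_addl.
(* The point k is frozen at stage k.+1, since k < k.+1 <= N k.+1. *)
pose A := [set k | S k.+1 k].
have AS m : agree_below (N m) A (S m).
  move=> k kN; rewrite /A /=.
  have [km|mk] := leqP k.+1 m; last exact: S_agree (ltnW mk) k kN.
  by have [] := S_agree _ _ km k (N_ge k.+1).
suff IA : density_ideal R F A.
  have : (char_seq @` density_ideal R F) (char_seq A) by exists A.
  by rewrite CI => -[m _]; apply: SC; apply: AS.
(* The right-hand side is the partial sum 2^-m + ... + 2^-(m + d - 1). *)
have slice m d n :
    rel_density R F [set k | A k /\ (N m <= k < N (m + d))%N] n
    <= 2 * 2^-1 ^+ m - 2 * 2^-1 ^+ (m + d).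
  elim: d => [|d IH].
    rewrite addn0 subrr -(rel_density_set0 R F n); apply: rel_density_le.
    by move=> k _ [_]; rewrite leqNgt; case: ltnP.
  have {}SAT := ST (m + d)%N n.
  have -> : 2 * 2^-1 ^+ (m + d.+1) = 2^-1 ^+ (m + d) :> R.
    by rewrite addnS exprS mulrA divff ?mul1r.
  have := rel_density_le_setU R F
    [set k | A k /\ (N m <= k < N (m + d.+1))%N]
    [set k | A k /\ (N m <= k < N (m + d))%N]
    [set k | S (m + d).+1 k /\ (N (m + d) <= k)%N] n.
  suff H : forall k, k \in F n -> A k /\ (N m <= k < N (m + d.+1))%N ->
      (A k /\ (N m <= k < N (m + d))%N) \/
      (S (m + d).+1 k /\ (N (m + d) <= k)%N).
    by move=> /(_ H); lra.
  move=> k _ [Ak /andP[mk kd]].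
  have [kN|Nk] := ltnP k (N (m + d)); first by left; rewrite mk.
  by right; split=> //; apply/(AS (m + d).+1) => //; rewrite -addnS.
apply/density_idealP => e e0.
have e2 : 0 < e / 2 by lra.
have [m mP] : exists m, 2 * 2^-1 ^+ m <= e / 2 :> R.
  exists (Num.bound (4 / e)); set m := Num.bound _.
  have lt2m : 4 / e < 2 ^+ m by apply: upper_nthrootP.
  rewrite exprVn ler_pdivrMr ?exprn_gt0 //.
  by move: lt2m; rewrite ltr_pdivrMr //; lra.
have [n0 n0P] := natr_div_card_small R F (N m) _ F_card e2.
exists n0 => n /n0P In.
have [M MP] := finite_family_bounded F n.+1.
(* F n is contained in [0, M), hence in [0, N (m + M)), so the first M blocks
   beyond N m cover all of A that F n can see. *)
have tail := slice m M n.
have Iden := rel_density_initial R F (N m) n.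
have q0 : 0 < 2^-1 ^+ (m + M) :> R by rewrite exprn_gt0 // invr_gt0.
have := rel_density_le_setU R F A `I_(N m)
  [set k | A k /\ (N m <= k < N (m + M))%N] n.
suff H : forall k, k \in F n -> A k ->
    `I_(N m) k \/ A k /\ (N m <= k < N (m + M))%N.
  by move=> /(_ H); lra.
move=> k kF Ak; have [km|mk] := ltnP k (N m); first by left.
right; split=> //; rewrite (leq_trans (MP n k (ltnSn n) kF)) //.
exact: leq_trans (leq_addl m M) (N_ge _).
Qed.
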